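(* For $q\in\mathbb{C}$ with $0<|q|<1$, \[ \left(1-\frac{1}{q}\right)\sum_{m=1}^{\infty}(q;q^2)_{m-1}\frac{q^{2m}}{1-q^{2m}}=\sum_{n=1}^{\infty}\frac{1}{(-q;q)_{n-1}}\frac{q^{2n}}{1-q^{2n}}-\sum_{n=1}^{\infty}\frac{q^n}{1+q^n}. \]
   Context: $(A;q)_n=\prod_{i=0}^{n-1}(1-Aq^i)$ for $n\ge0$ (empty product $=1$); in particular $(q;q^2)_{m-1}=\prod_{i=0}^{m-2}(1-q^{2i+1})$. *)

(* Defs.v *)
From Stdlib Require Import Reals.
From Coquelicot Require Import Coquelicot.

Local Open Scope C_scope.

Fixpoint qpoch (A q : C) (n : nat) : C :=
  match n with
  | O => 1
  | S k => qpoch A q k * (1 - A * q ^ k)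
  end.

(* The series f 1 + f 2 + f 3 + ... converges to l; f 0 is not a term. *)
Definition is_series_from1 (f : nat -> C) (l : C) : Prop :=
  is_series (fun k : nat => f (S k)) l.

(* Main.v *)
Require Import Defs.
From Stdlib Require Import Reals Lra Lia.
From Coquelicot Require Import Coquelicot.

(** Write [p_j = (q^(j+1); q)_oo], [e_j = 1 / (-q^(j+1); q)_oo] and [d_j = e_j - p_j = O(q^(2j))].
    Every sum of the theorem reduces to [D = sum_j d_j].

    - [(q; q^2)_k = (q; q)_(2k) / (q^2; q^2)_k] and [(q; q)_(2k) = sum_j p_j q^((2k+1) j)]; exchanging
      the sums over [k] and [j], Euler's [sum_m x^m / (q^2; q^2)_m = 1 / (x; q^2)_oo] at [x = q^(2j+2)]
      turns the first series into [S1 = sum_j d_j / q^j]. Abel summation with the recurrences of [p]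
      and [e] gives [(1 - 1/q) S1 = D + e_0 - 1].
    - Put [w_n = q^n / (1 - q^n)], [V(a) = sum_(n >= 1) w_n / (-a; q)_n] and
      [L(a) = sum_(n >= 1) w_n (a; q)_n]. The differences [V(a) - V(aq)] and [L(aq) - L(a)] telescope
      to infinite products, [V(aq) - L(a) -> 0] as [a -> 0] and [L(1) = 0]; summing over [a = q^k]
      yields [V(q) = S3 + D].
    - [q^(2n) / (1 - q^n) = w_n - q^n] and the sum of the [q^n / (-q; q)_n] telescopes, hence
      [S2 = V(q) - (1 - e_0)]. *)

Local Open Scope C_scope.

(** * Limits and series of complex numbers *)

(** Convergence is read off the real sequence of moduli, so that squeeze and domination arguments
    take place in [R]. *)
Definition Clim (u : nat -> C) (l : C) : Prop :=
  is_lim_seq (fun n => Cmod (u n - l)) 0%R.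

(** The index [n] is excluded, in contrast to [sum_n]: the empty sum is available and [n] counts the
    terms. *)
Fixpoint csum (f : nat -> C) (n : nat) : C :=
  match n with
  | O => 0
  | S k => csum f k + f k
  end.

Lemma csum_S (f : nat -> C) (n : nat) : csum f (S n) = csum f n + f n.
Proof. reflexivity. Qed.

Lemma csum_S_l (f : nat -> C) (n : nat) : csum f (S n) = f O + csum (fun k => f (S k)) n.
Proof.
  induction n as [|n IH]; [simpl; ring|].
  change (csum f (S (S n))) with (csum f (S n) + f (S n)). rewrite IH. simpl. ring.
Qed.

Lemma Cmod_sym (x y : C) : Cmod (x - y) = Cmod (y - x).
Proof. rewrite <- Cmod_opp. f_equal. ring. Qed.

Lemma Cmod_minus_triangle (x y z : C) :
  (Cmod (x - z) <= Cmod (x - y) + Cmod (y - z))%R.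
Proof. replace (x - z) with ((x - y) + (y - z)) by ring. apply Cmod_triangle. Qed.

Lemma Cmod_le_near_1 (x : C) (e : R) : (Cmod (x - 1) <= e)%R -> (Cmod x <= 1 + e)%R.
Proof.
  intros H. replace x with ((x - 1) + 1) by ring.
  eapply Rle_trans; [apply Cmod_triangle|]. rewrite Cmod_1. lra.
Qed.

Lemma Cmod_1_minus_ge (x : C) : (1 - Cmod x <= Cmod (1 - x))%R.
Proof.
  pose proof (Cmod_triangle (1 - x) x) as H.
  replace (1 - x + x) with (1 : C) in H by ring. rewrite Cmod_1 in H. lra.
Qed.

Lemma one_minus_neq_0 (x : C) : (Cmod x < 1)%R -> 1 - x <> 0.
Proof.
  intros H E. pose proof (Cmod_1_minus_ge x). rewrite E, Cmod_0 in *. lra.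
Qed.

Lemma one_plus_neq_0 (x : C) : (Cmod x < 1)%R -> 1 + x <> 0.
Proof.
  intros H. replace (1 + x) with (1 - - x) by ring.
  apply one_minus_neq_0. now rewrite Cmod_opp.
Qed.

Lemma pow_le_base (r : R) (n : nat) : (0 <= r <= 1 -> r ^ S n <= r)%R.
Proof.
  intros H. simpl.
  assert (r ^ n <= 1)%R by (rewrite <- (pow1 n); apply pow_incr; lra). nra.
Qed.

Lemma pow_le_1 (r : R) (n : nat) : (0 <= r <= 1 -> 0 <= r ^ n <= 1)%R.
Proof.
  intros H. split; [apply pow_le; lra|].
  rewrite <- (pow1 n). apply pow_incr. lra.
Qed.

Lemma Cmod_pow_S_le (q : C) (n : nat) : (Cmod q < 1 -> Cmod (q ^ S n) <= Cmod q)%R.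
Proof.
  intros H. rewrite Cmod_pow. apply pow_le_base. pose proof (Cmod_ge_0 q). lra.
Qed.

Lemma Cmod_pow_S_lt_1 (q : C) (n : nat) : (Cmod q < 1 -> Cmod (q ^ S n) < 1)%R.
Proof. intros H. pose proof (Cmod_pow_S_le q n H). lra. Qed.

Lemma Clim_unique (u : nat -> C) (l l' : C) : Clim u l -> Clim u l' -> l = l'.
Proof.
  intros H H'.
  assert (E : Cmod (l - l') = 0%R).
  { apply Rle_antisym; [|apply Cmod_ge_0].
    change (Rbar_le (Cmod (l - l')) (0%R)).
    eapply is_lim_seq_le;
      [| apply is_lim_seq_const
       | replace 0%R with (0 + 0)%R by ring; apply (is_lim_seq_plus' _ _ _ _ H H')].
    intros n. simpl. rewrite (Cmod_sym (u n) l). apply Cmod_minus_triangle. }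
  apply Cmod_eq_0 in E. replace l with ((l - l') + l') by ring. rewrite E. ring.
Qed.

Lemma Clim_ext (u v : nat -> C) (l : C) : (forall n, u n = v n) -> Clim u l -> Clim v l.
Proof. intros E. apply is_lim_seq_ext. intros n. now rewrite E. Qed.

Lemma Clim_squeeze (u : nat -> C) (l : C) (b : nat -> R) :
  (forall n, (Cmod (u n - l) <= b n)%R) -> is_lim_seq b 0%R -> Clim u l.
Proof.
  intros H Hb. eapply is_lim_seq_le_le; [|apply is_lim_seq_const|exact Hb].
  intros n. split; [apply Cmod_ge_0 | apply H].
Qed.

Lemma is_lim_seq_scal_geom (K r : R) :
  (0 <= r < 1)%R -> is_lim_seq (fun n => K * r ^ n)%R 0%R.
Proof.
  intros Hr. replace 0%R with (K * 0)%R by ring.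
  apply is_lim_seq_mult'; [apply is_lim_seq_const|].
  apply is_lim_seq_geom. rewrite Rabs_pos_eq; lra.
Qed.

Lemma Clim_geom (u : nat -> C) (l : C) (K r : R) :
  (0 <= r < 1)%R -> (forall n, (Cmod (u n - l) <= K * r ^ n)%R) -> Clim u l.
Proof.
  intros Hr H. eapply Clim_squeeze; [exact H|]. now apply is_lim_seq_scal_geom.
Qed.

Lemma Clim_plus (u v : nat -> C) (l m : C) :
  Clim u l -> Clim v m -> Clim (fun n => u n + v n) (l + m).
Proof.
  intros Hu Hv. eapply Clim_squeeze.
  2:{ replace 0%R with (0 + 0)%R by ring. apply (is_lim_seq_plus' _ _ _ _ Hu Hv). }
  intros n. simpl. replace (u n + v n - (l + m)) with ((u n - l) + (v n - m)) by ring.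
  apply Cmod_triangle.
Qed.

Lemma Clim_scal (u : nat -> C) (c l : C) : Clim u l -> Clim (fun n => c * u n) (c * l).
Proof.
  intros Hu. eapply Clim_squeeze.
  2:{ replace 0%R with (Cmod c * 0)%R by ring.
      apply is_lim_seq_mult'; [apply is_lim_seq_const|exact Hu]. }
  intros n. simpl. replace (c * u n - c * l) with (c * (u n - l)) by ring.
  rewrite Cmod_mult. lra.
Qed.

Lemma Clim_const (c : C) : Clim (fun _ => c) c.
Proof.
  eapply Clim_squeeze; [|apply is_lim_seq_const].
  intros n. replace (c - c) with (0 : C) by ring. rewrite Cmod_0. lra.
Qed.

Lemma Clim_incr_1 (u : nat -> C) (l : C) : Clim (fun n => u (S n)) l <-> Clim u l.
Proof. symmetry. apply (is_lim_seq_incr_1 (fun n => Cmod (u n - l))). Qed.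

(** A closed ball contains the limits of its sequences. This carries bounds uniform in [n] over to
    infinite products and sums. *)
Lemma Clim_bound (u : nat -> C) (a l : C) (K : R) :
  (forall n, (Cmod (u n - a) <= K)%R) -> Clim u l -> (Cmod (l - a) <= K)%R.
Proof.
  intros H Hu. pose proof (is_lim_seq_plus' _ _ _ _ Hu (is_lim_seq_const K)) as Hs.
  rewrite Rplus_0_l in Hs. change (Rbar_le (Cmod (l - a)) K).
  eapply is_lim_seq_le; [| apply is_lim_seq_const | exact Hs].
  intros n. simpl. rewrite (Cmod_sym (u n)).
  eapply Rle_trans; [apply (Cmod_minus_triangle l (u n) a)|]. specialize (H n). lra.
Qed.

Lemma csum_sum_n (f : nat -> C) (n : nat) : csum f (S n) = sum_n f n.
Proof.
  induction n as [|n IH].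
  - rewrite sum_O. simpl. ring.
  - rewrite sum_Sn, <- IH. reflexivity.
Qed.

Lemma is_series_csum (f : nat -> C) (l : C) : is_series f l <-> Clim (csum f) l.
Proof.
  rewrite <- Clim_incr_1. split; intros H.
  - apply is_lim_seq_spec. intros eps.
    assert (He : (0 < eps)%R) by apply cond_pos.
    pose proof (proj1 (filterlim_locally_ball_norm _ _) H eps) as [N HN].
    exists N. intros n Hn. specialize (HN n Hn).
    rewrite csum_sum_n, Rminus_0_r, Rabs_pos_eq by apply Cmod_ge_0. exact HN.
  - apply (proj2 (filterlim_locally_ball_norm _ _)). intros eps.
    apply is_lim_seq_spec in H. destruct (H eps) as [N HN].
    exists N. intros n Hn. specialize (HN n Hn).
    rewrite csum_sum_n, Rminus_0_r, Rabs_pos_eq in HN by apply Cmod_ge_0. exact HN.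
Qed.

Lemma is_series_unique_C (f : nat -> C) (l l' : C) : is_series f l -> is_series f l' -> l = l'.
Proof. rewrite !is_series_csum. apply Clim_unique. Qed.

Lemma is_series_ext_C (f g : nat -> C) (l : C) :
  (forall n, f n = g n) -> is_series f l -> is_series g l.
Proof. apply (is_series_ext (V := C_NormedModule)). Qed.

Lemma is_series_plus_C (f g : nat -> C) (l m : C) :
  is_series f l -> is_series g m -> is_series (fun n => f n + g n) (l + m).
Proof. apply (is_series_plus (V := C_NormedModule)). Qed.

Lemma is_series_scal_C (c : C) (f : nat -> C) (l : C) :
  is_series f l -> is_series (fun n => c * f n) (c * l).
Proof. apply (is_series_scal (V := C_NormedModule)). Qed.

Lemma is_series_minus_C (f g : nat -> C) (l m : C) :
  is_series f l -> is_series g m -> is_series (fun n => f n - g n) (l - m).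
Proof. apply (is_series_minus (V := C_NormedModule)). Qed.

Lemma is_series_shift_C (f : nat -> C) (l : C) :
  is_series f l <-> is_series (fun n => f (S n)) (l - f O).
Proof.
  rewrite !is_series_csum, <- (Clim_incr_1 (csum f)). split; intros H.
  - eapply Clim_ext with (u := fun n => csum f (S n) + - f O).
    + intros n. rewrite csum_S_l. ring.
    + apply Clim_plus; [exact H | apply Clim_const].
  - eapply Clim_ext with (u := fun n => csum (fun k => f (S k)) n + f O).
    + intros n. rewrite csum_S_l. ring.
    + replace l with (l - f O + f O) by ring. apply Clim_plus; [exact H | apply Clim_const].
Qed.

Lemma is_series_drop_C (f : nat -> C) (l : C) (n : nat) :
  is_series f l -> is_series (fun k => f (n + k)%nat) (l - csum f n).
Proof.
  intros H. induction n as [|n IH]; simpl csum.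
  - replace (l - 0) with l by ring. exact H.
  - apply is_series_shift_C in IH. rewrite Nat.add_0_r in IH.
    replace (l - (csum f n + f n)) with (l - csum f n - f n) by ring.
    eapply is_series_ext_C; [|exact IH]. intros k. simpl. now rewrite Nat.add_succ_r.
Qed.

Lemma is_series_telescope (u : nat -> C) (l : C) :
  Clim u l -> is_series (fun n => u n - u (S n)) (u O - l).
Proof.
  intros H. apply is_series_csum.
  apply Clim_ext with (u := fun n => u O + (-(1)) * u n).
  - induction n as [|n IH]; simpl; [ring|]. rewrite <- IH. ring.
  - replace (u O - l) with (u O + (-(1)) * l) by ring.
    apply Clim_plus; [apply Clim_const | now apply Clim_scal].
Qed.

Lemma csum_geom_bound (f : nat -> C) (K r : R) (n : nat) :
  (0 <= r < 1)%R -> (0 <= K)%R -> (forall n, (Cmod (f n) <= K * r ^ n)%R) ->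
  (Cmod (csum f n) <= K / (1 - r))%R.
Proof.
  intros Hr HK H.
  assert (B : (Cmod (csum f n) <= K * ((1 - r ^ n) / (1 - r)))%R).
  { induction n as [|n IH]; simpl csum.
    - rewrite Cmod_0. simpl. right. field. lra.
    - eapply Rle_trans; [apply Cmod_triangle|].
      replace (K * ((1 - r ^ S n) / (1 - r)))%R
        with (K * ((1 - r ^ n) / (1 - r)) + K * r ^ n)%R by (simpl; field; lra).
      specialize (H n). lra. }
  eapply Rle_trans; [exact B|]. unfold Rdiv.
  apply Rmult_le_compat_l; [lra|].
  rewrite <- (Rmult_1_l (/ (1 - r))) at 2.
  apply Rmult_le_compat_r; [left; apply Rinv_0_lt_compat; lra|].
  pose proof (pow_le r n). lra.
Qed.

Lemma series_geom_bound (f : nat -> C) (l : C) (K r : R) :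
  (0 <= r < 1)%R -> (forall n, (Cmod (f n) <= K * r ^ n)%R) ->
  is_series f l -> (Cmod l <= K / (1 - r))%R.
Proof.
  intros Hr H Hl.
  assert (HK : (0 <= K)%R).
  { pose proof (H O) as H0. simpl in H0. pose proof (Cmod_ge_0 (f O)). lra. }
  replace l with (l - 0) by ring. apply is_series_csum in Hl.
  eapply Clim_bound; [|exact Hl]. intros n.
  replace (csum f n - 0) with (csum f n) by ring. now apply csum_geom_bound.
Qed.

(** A total choice of the sum, meaningful only once convergence is known; below, convergence always
    comes from [is_Cseries_geom]. *)
Definition Cseries (f : nat -> C) : C :=
  iota (T := CompleteNormedModule.CompleteSpace _ C_CompleteNormedModule) (is_series f).

Lemma Cseries_correct (f : nat -> C) (l : C) : is_series f l -> is_series f (Cseries f).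
Proof.
  intros H. refine (iota_correct (V := C_CompleteNormedModule) (is_series f) _).
  exists l. split; [exact H|].
  intros l' H'. exact (is_series_unique_C _ _ _ H H').
Qed.

Lemma is_Cseries_geom (f : nat -> C) (K r : R) :
  (0 <= r < 1)%R -> (forall n, (Cmod (f n) <= K * r ^ n)%R) -> is_series f (Cseries f).
Proof.
  intros Hr H.
  destruct (ex_series_le (V := C_CompleteNormedModule) f (fun n => K * r ^ n)%R) as [l Hl].
  - exact H.
  - apply (ex_series_scal (V := R_NormedModule) K (pow r)). apply ex_series_geom.
    rewrite Rabs_pos_eq; lra.
  - exact (Cseries_correct f l Hl).
Qed.

(** * Uniform bounds for finite q-products *)

Lemma Rexp_le (x y : R) : (x <= y -> exp x <= exp y)%R.
Proof.
  intros [H | ->]; [left; now apply exp_increasing | apply Rle_refl].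
Qed.

(** From 1 + x <= exp x the products stay below exp(D / (1 - r)); summing P_(n+1) - P_n = P_n u_n
    then bounds P_n - 1. The result is linear in [d], with a constant depending only on [D] and [r]:
    this gives uniformity in [n] and smallness with [d]. *)
Lemma prod_near_1 (P u : nat -> C) (r d D : R) :
  (0 <= r < 1)%R -> (0 <= d <= D)%R ->
  P O = 1 -> (forall n, P (S n) = P n * (1 + u n)) ->
  (forall n, (Cmod (u n) <= d * r ^ n)%R) ->
  forall n, (Cmod (P n - 1) <= exp (D / (1 - r)) / (1 - r) * d)%R.
Proof.
  intros Hr Hd P0 PS Hu.
  assert (Hi : (0 < / (1 - r))%R) by (apply Rinv_0_lt_compat; lra).
  assert (B : forall n, (Cmod (P n) <= exp (d * ((1 - r ^ n) / (1 - r))))%R).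
  { induction n as [|n IH].
    - rewrite P0, Cmod_1. simpl. replace (d * ((1 - 1) / (1 - r)))%R with 0%R by (field; lra).
      rewrite exp_0. lra.
    - rewrite PS, Cmod_mult.
      replace (d * ((1 - r ^ S n) / (1 - r)))%R
        with (d * ((1 - r ^ n) / (1 - r)) + d * r ^ n)%R by (simpl; field; lra).
      rewrite exp_plus. apply Rmult_le_compat; try apply Cmod_ge_0; [exact IH|].
      eapply Rle_trans; [apply Cmod_triangle|]. rewrite Cmod_1.
      pose proof (exp_ineq1_le (d * r ^ n)). specialize (Hu n). lra. }
  assert (B' : forall n, (Cmod (P n) <= exp (D / (1 - r)))%R).
  { intros n. eapply Rle_trans; [apply B|].
    apply Rexp_le. pose proof (pow_le_1 r n). unfold Rdiv.
    rewrite <- Rmult_assoc. apply Rmult_le_compat_r; [lra|]. nra. }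
  assert (Q : forall n, (Cmod (P n - 1) <= exp (D / (1 - r)) * d * ((1 - r ^ n) / (1 - r)))%R).
  { induction n as [|n IH].
    - rewrite P0. replace (1 - 1) with (0 : C) by ring. rewrite Cmod_0. simpl. right. field. lra.
    - rewrite PS. replace (P n * (1 + u n) - 1) with ((P n - 1) + P n * u n) by ring.
      eapply Rle_trans; [apply Cmod_triangle|]. rewrite Cmod_mult.
      replace (exp (D / (1 - r)) * d * ((1 - r ^ S n) / (1 - r)))%R
        with (exp (D / (1 - r)) * d * ((1 - r ^ n) / (1 - r)) + exp (D / (1 - r)) * (d * r ^ n))%R
        by (simpl; field; lra).
      apply Rplus_le_compat; [exact IH|].
      apply Rmult_le_compat; try apply Cmod_ge_0; [apply B'|apply Hu]. }
  intros n. eapply Rle_trans; [apply Q|].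
  assert (E : (0 < exp (D / (1 - r)))%R) by apply exp_pos.
  replace (exp (D / (1 - r)) / (1 - r) * d)%R
    with (exp (D / (1 - r)) * d * (1 / (1 - r)))%R by (field; lra).
  apply Rmult_le_compat_l; [nra|]. unfold Rdiv.
  apply Rmult_le_compat_r; [lra|]. pose proof (pow_le_1 r n). lra.
Qed.

Lemma qpoch_near_1 (q : C) : (Cmod q < 1)%R ->
  exists M : R, (0 <= M)%R /\
    forall a n, (Cmod a <= 1)%R -> (Cmod (qpoch a q n - 1) <= M * Cmod a)%R.
Proof.
  intros Hq. pose proof (Cmod_ge_0 q) as Hq0.
  exists (exp (1 / (1 - Cmod q)) / (1 - Cmod q))%R. split.
  { apply Rmult_le_pos; [left; apply exp_pos | left; apply Rinv_0_lt_compat; lra]. }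
  intros a n Ha.
  apply prod_near_1 with (u := fun n => - (a * q ^ n)); try easy.
  - split; [apply Cmod_ge_0 | exact Ha].
  - intros k. rewrite Cmod_opp, Cmod_mult, Cmod_pow. lra.
Qed.

Lemma qpoch_factor_lt_1 (a q : C) (n : nat) :
  (Cmod q < 1 -> Cmod a < 1 -> Cmod (a * q ^ n) < 1)%R.
Proof.
  intros Hq Ha. rewrite Cmod_mult, Cmod_pow.
  pose proof (pow_le_1 (Cmod q) n). pose proof (Cmod_ge_0 q). pose proof (Cmod_ge_0 a). nra.
Qed.

Lemma qpoch_neq_0 (a q : C) (n : nat) :
  (Cmod q < 1)%R -> (Cmod a < 1)%R -> qpoch a q n <> 0.
Proof.
  intros Hq Ha. induction n as [|n IH]; simpl.
  - apply C1_nz.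
  - apply Cmult_neq_0; [exact IH|]. now apply one_minus_neq_0, qpoch_factor_lt_1.
Qed.

(** The factors are 1 / (1 - x) = 1 + x / (1 - x) with x = a q^k, and |1 - x| >= 1 - |q| because |a|
    <= |q|. Hence [prod_near_1] applies with d = |a| / (1 - |q|) and D = 1 / (1 - |q|). *)
Lemma inv_qpoch_near_1 (q : C) : (Cmod q < 1)%R ->
  exists M : R, (0 <= M)%R /\
    forall a n, (Cmod a <= Cmod q)%R -> (Cmod (/ qpoch a q n - 1) <= M * Cmod a)%R.
Proof.
  intros Hq. pose proof (Cmod_ge_0 q) as Hq0.
  assert (Hi : (0 < / (1 - Cmod q))%R) by (apply Rinv_0_lt_compat; lra).
  exists (exp (/ (1 - Cmod q) / (1 - Cmod q)) / (1 - Cmod q) * / (1 - Cmod q))%R. split.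
  { apply Rmult_le_pos; [apply Rmult_le_pos|]; try lra. left; apply exp_pos. }
  intros a n Ha. pose proof (Cmod_ge_0 a) as Ha0.
  rewrite Rmult_assoc.
  apply prod_near_1 with (P := fun n => / qpoch a q n)
    (u := fun n => a * q ^ n / (1 - a * q ^ n)).
  - lra.
  - split; [apply Rmult_le_pos; lra|].
    rewrite <- (Rmult_1_r (/ (1 - Cmod q))) at 2. apply Rmult_le_compat_l; lra.
  - simpl. field.
  - intros k. simpl.
    assert (1 - a * q ^ k <> 0) by (apply one_minus_neq_0, qpoch_factor_lt_1; lra).
    assert (qpoch a q k <> 0) by (apply qpoch_neq_0; lra).
    field. now split.
  - intros k.
    assert (1 - a * q ^ k <> 0) by (apply one_minus_neq_0, qpoch_factor_lt_1; lra).
    rewrite Cmod_div by assumption.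
    pose proof (Cmod_1_minus_ge (a * q ^ k)) as Hge.
    rewrite Cmod_mult, Cmod_pow in *.
    pose proof (pow_le_1 (Cmod q) k ltac:(lra)).
    assert (Hinv : (/ Cmod (1 - a * q ^ k) <= / (1 - Cmod q))%R).
    { apply Rinv_le_contravar; [lra|]. nra. }
    replace (/ (1 - Cmod q) * Cmod a * Cmod q ^ k)%R
      with (Cmod a * Cmod q ^ k * / (1 - Cmod q))%R by ring.
    apply Rmult_le_compat_l; [nra | exact Hinv].
Qed.

(** * Infinite products *)

Lemma qpoch_shift (a q : C) (n : nat) : qpoch a q (S n) = (1 - a) * qpoch (a * q) q n.
Proof.
  induction n as [|n IH]; [simpl; ring|].
  change (qpoch a q (S (S n))) with (qpoch a q (S n) * (1 - a * q ^ S n)).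
  rewrite IH. simpl. ring.
Qed.

(* [(a; q)_oo], as [1] minus the telescoping sum of [(a; q)_n - (a; q)_(n+1)]. *)
Definition qinf (a q : C) : C := 1 - Cseries (fun n => a * q ^ n * qpoch a q n).

Lemma qinf_series (a q : C) : (Cmod q < 1)%R -> (Cmod a <= 1)%R ->
  is_series (fun n => a * q ^ n * qpoch a q n) (1 - qinf a q).
Proof.
  intros Hq Ha. destruct (qpoch_near_1 q Hq) as [M [HM B]].
  pose proof (Cmod_ge_0 q). pose proof (Cmod_ge_0 a).
  unfold qinf.
  match goal with |- is_series ?f _ => replace (1 - (1 - Cseries f)) with (Cseries f) by ring end.
  apply is_Cseries_geom with (K := (1 + M)%R) (r := Cmod q); [lra|].
  intros n. rewrite !Cmod_mult, Cmod_pow.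
  pose proof (Cmod_le_near_1 _ _ (B a n Ha)).
  pose proof (Cmod_ge_0 (qpoch a q n)).
  pose proof (pow_le_1 (Cmod q) n ltac:(lra)).
  replace ((1 + M) * Cmod q ^ n)%R with (1 * Cmod q ^ n * (1 + M))%R by ring.
  apply Rmult_le_compat; [nra | lra | apply Rmult_le_compat_r; lra | nra].
Qed.

Lemma qinf_lim (a q : C) : (Cmod q < 1)%R -> (Cmod a <= 1)%R ->
  Clim (qpoch a q) (qinf a q).
Proof.
  intros Hq Ha. pose proof (qinf_series a q Hq Ha) as H. apply is_series_csum in H.
  apply Clim_ext with (u := fun n => 1 + (-(1)) * csum (fun n => a * q ^ n * qpoch a q n) n).
  - induction n as [|n IH]; simpl; [ring|]. rewrite <- IH. ring.
  - replace (qinf a q) with (1 + (-(1)) * (1 - qinf a q)) by ring.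
    apply Clim_plus; [apply Clim_const | now apply Clim_scal].
Qed.

Lemma Cmod_mult_le (a q : C) : (Cmod q <= 1)%R -> (Cmod (a * q) <= Cmod a)%R.
Proof. intros H. rewrite Cmod_mult. pose proof (Cmod_ge_0 a). nra. Qed.

Lemma qinf_shift (a q : C) : (Cmod q < 1)%R -> (Cmod a <= 1)%R ->
  qinf a q = (1 - a) * qinf (a * q) q.
Proof.
  intros Hq Ha. apply (Clim_unique (fun n => qpoch a q (S n))).
  - apply (Clim_incr_1 (qpoch a q)). now apply qinf_lim.
  - apply Clim_ext with (u := fun n => (1 - a) * qpoch (a * q) q n).
    + intros n. now rewrite qpoch_shift.
    + apply Clim_scal, qinf_lim; [exact Hq|].
      pose proof (Cmod_mult_le a q). lra.
Qed.

Lemma qinf_near_1 (q : C) : (Cmod q < 1)%R ->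
  exists M : R, (0 <= M)%R /\
    forall a, (Cmod a <= 1)%R -> (Cmod (qinf a q - 1) <= M * Cmod a)%R.
Proof.
  intros Hq. destruct (qpoch_near_1 q Hq) as [M [HM B]].
  exists M. split; [exact HM|]. intros a Ha.
  apply Clim_bound with (u := qpoch a q); [|now apply qinf_lim].
  intros n. now apply B.
Qed.

(* By Euler, [euler x q] is [1 / (x; q)_oo]; only its functional equation is needed. *)
Definition euler (x q : C) : C := Cseries (fun n => x ^ n / qpoch q q n).

Lemma inv_qpoch_bound (q : C) : (Cmod q < 1)%R ->
  exists M : R, (0 <= M)%R /\
    forall a n, (Cmod a <= Cmod q)%R -> (Cmod (/ qpoch a q n) <= M)%R.
Proof.
  intros Hq. destruct (inv_qpoch_near_1 q Hq) as [M [HM B]].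
  pose proof (Cmod_ge_0 q).
  exists (1 + M)%R. split; [lra|]. intros a n Ha.
  pose proof (Cmod_le_near_1 _ _ (B a n Ha)). pose proof (Cmod_ge_0 a). nra.
Qed.

Lemma euler_term_bound (q : C) : (Cmod q < 1)%R ->
  exists M : R, (0 <= M)%R /\
    forall x n, (Cmod (x ^ n / qpoch q q n) <= M * Cmod x ^ n)%R.
Proof.
  intros Hq. destruct (inv_qpoch_bound q Hq) as [M [HM B]].
  exists M. split; [exact HM|]. intros x n. unfold Cdiv.
  rewrite Cmod_mult, Cmod_pow, Rmult_comm.
  apply Rmult_le_compat_r; [apply pow_le, Cmod_ge_0 | apply B; lra].
Qed.

Lemma euler_series (x q : C) : (Cmod q < 1)%R -> (Cmod x < 1)%R ->
  is_series (fun n => x ^ n / qpoch q q n) (euler x q).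
Proof.
  intros Hq Hx. destruct (euler_term_bound q Hq) as [M [_ B]].
  apply is_Cseries_geom with (K := M) (r := Cmod x); [|apply B].
  split; [apply Cmod_ge_0 | exact Hx].
Qed.

(** In [euler x q - euler (x * q) q] the terms of index 0 cancel, and the factor 1 - q^(n+1) cancels
    the last factor of (q; q)_(n+1); what remains is x times the series itself. *)
Lemma euler_shift (x q : C) : (Cmod q < 1)%R -> (Cmod x < 1)%R ->
  euler (x * q) q = (1 - x) * euler x q.
Proof.
  intros Hq Hx.
  assert (Hxq : (Cmod (x * q) < 1)%R) by (pose proof (Cmod_mult_le x q); lra).
  pose proof (euler_series x q Hq Hx) as E.
  pose proof (is_series_minus_C _ _ _ _ E (euler_series (x * q) q Hq Hxq)) as D.
  apply is_series_shift_C in D.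
  assert (S : euler x q - euler (x * q) q - (x ^ 0 / qpoch q q 0 - (x * q) ^ 0 / qpoch q q 0)
              = x * euler x q).
  { eapply is_series_unique_C; [exact D|].
    eapply is_series_ext_C; [|apply (is_series_scal_C x _ _ E)].
    intros n. simpl.
    assert (qpoch q q n <> 0) by (now apply qpoch_neq_0).
    assert (1 - q * q ^ n <> 0) by (apply one_minus_neq_0, qpoch_factor_lt_1; lra).
    rewrite Cpow_mult_l. field. now split. }
  replace (euler (x * q) q) with (euler x q - (euler x q - euler (x * q) q)) by ring.
  replace (euler x q - euler (x * q) q) with (x * euler x q); [ring|].
  rewrite <- S. simpl. ring.
Qed.

(** The tail is summed with ratio |q| instead of |x|, so [M] does not depend on [x] while the factor
    |x|^n survives. The case n = 1 gives [euler_near_1]; general n controls the truncation in the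
    exchange of sums. *)
Lemma euler_tail (q : C) : (Cmod q < 1)%R ->
  exists M : R, (0 <= M)%R /\
    forall x n, (Cmod x <= Cmod q)%R ->
      (Cmod (euler x q - csum (fun k => (x ^ k / qpoch q q k)%C) n) <= M * Cmod x ^ n)%R.
Proof.
  intros Hq. destruct (euler_term_bound q Hq) as [M [HM B]].
  pose proof (Cmod_ge_0 q).
  exists (M / (1 - Cmod q))%R. split.
  { apply Rmult_le_pos; [exact HM|]. left. apply Rinv_0_lt_compat. lra. }
  intros x n Hx. pose proof (Cmod_ge_0 x).
  pose proof (is_series_drop_C _ _ n (euler_series x q Hq ltac:(lra))) as E.
  replace (M / (1 - Cmod q) * Cmod x ^ n)%R with (M * Cmod x ^ n / (1 - Cmod q))%R by (field; lra).
  eapply series_geom_bound; [| |exact E]; [lra|].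
  intros k. eapply Rle_trans; [apply B|]. rewrite pow_add, <- Rmult_assoc.
  apply Rmult_le_compat_l; [|apply pow_incr; lra].
  apply Rmult_le_pos; [exact HM|]. now apply pow_le.
Qed.

Lemma euler_near_1 (q : C) : (Cmod q < 1)%R ->
  exists M : R, (0 <= M)%R /\
    forall x, (Cmod x <= Cmod q)%R -> (Cmod (euler x q - 1) <= M * Cmod x)%R.
Proof.
  intros Hq. destruct (euler_tail q Hq) as [M [HM B]].
  exists M. split; [exact HM|]. intros x Hx. specialize (B x 1%nat Hx). simpl in B.
  rewrite Rmult_1_r in B. replace (0 + 1 / 1) with (1 : C) in B by field. exact B.
Qed.

(* [1 / (-a; q)_oo], through [(a; q)_oo (-a; q)_oo = (a^2; q^2)_oo]. *)
Definition iqinf (a q : C) : C := qinf a q * euler (a ^ 2) (q ^ 2).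

Lemma Cmod_sqr_lt_1 (a : C) : (Cmod a < 1)%R -> (Cmod (a ^ 2) < 1)%R.
Proof. apply (Cmod_pow_S_lt_1 a 1). Qed.

(** The Euler factor contributes 1 - a^2 = (1 - a)(1 + a), and 1 - a is absorbed by [qinf]. *)
Lemma iqinf_shift (a q : C) : (Cmod q < 1)%R -> (Cmod a < 1)%R ->
  iqinf (a * q) q = (1 + a) * iqinf a q.
Proof.
  intros Hq Ha. unfold iqinf. rewrite (qinf_shift a q) by lra.
  rewrite Cpow_mult_l, euler_shift by (now apply Cmod_sqr_lt_1). ring.
Qed.

(** The Euler factor is taken at a^2, hence the quadratic order. It makes d_j / q^j summable later
    on. *)
Lemma iqinf_minus_qinf (q : C) : (Cmod q < 1)%R ->
  exists M : R, (0 <= M)%R /\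
    forall a, (Cmod a <= Cmod q)%R -> (Cmod (iqinf a q - qinf a q) <= M * Cmod a ^ 2)%R.
Proof.
  intros Hq. destruct (qinf_near_1 q Hq) as [M [HM B]].
  destruct (euler_near_1 (q ^ 2) (Cmod_sqr_lt_1 q Hq)) as [M' [HM' B']].
  exists ((1 + M) * M')%R. split; [apply Rmult_le_pos; lra|].
  intros a Ha. pose proof (Cmod_ge_0 a). unfold iqinf.
  replace (qinf a q * euler (a ^ 2) (q ^ 2) - qinf a q)
    with (qinf a q * (euler (a ^ 2) (q ^ 2) - 1)) by ring.
  rewrite Cmod_mult, Rmult_assoc. apply Rmult_le_compat; try apply Cmod_ge_0.
  - pose proof (Cmod_le_near_1 _ _ (B a ltac:(lra))). nra.
  - rewrite <- Cmod_pow. apply B'. rewrite !Cmod_pow. apply pow_incr. lra.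
Qed.

Lemma iqinf_near_1 (q : C) : (Cmod q < 1)%R ->
  exists M : R, (0 <= M)%R /\
    forall a, (Cmod a <= Cmod q)%R -> (Cmod (iqinf a q - 1) <= M * Cmod a)%R.
Proof.
  intros Hq. destruct (qinf_near_1 q Hq) as [M [HM B]].
  destruct (iqinf_minus_qinf q Hq) as [M' [HM' B']].
  exists (M' + M)%R. split; [lra|]. intros a Ha. pose proof (Cmod_ge_0 a).
  eapply Rle_trans; [apply (Cmod_minus_triangle _ (qinf a q))|].
  rewrite Rmult_plus_distr_r. apply Rplus_le_compat; [|apply B; lra].
  eapply Rle_trans; [now apply B'|]. apply Rmult_le_compat_l; [lra|].
  simpl. rewrite Rmult_1_r. nra.
Qed.

Lemma iqinf_shift_n (a q : C) (n : nat) : (Cmod q < 1)%R -> (Cmod a < 1)%R ->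
  iqinf (a * q ^ n) q = qpoch (- a) q n * iqinf a q.
Proof.
  intros Hq Ha. induction n as [|n IH]; simpl.
  - replace (a * 1) with a by ring. ring.
  - replace (a * (q * q ^ n)) with (a * q ^ n * q) by ring.
    rewrite iqinf_shift, IH by (try apply qpoch_factor_lt_1; lra). ring.
Qed.

(** The functional equation iterated n times, together with [iqinf] tending to 1 at 0, identifies
    the limit: the error is 1 / (-a; q)_n times [iqinf (a * q ^ n) q - 1], up to sign. *)
Lemma iqinf_lim (a q : C) : (Cmod q < 1)%R -> (Cmod a <= Cmod q)%R ->
  Clim (fun n => / qpoch (- a) q n) (iqinf a q).
Proof.
  intros Hq Ha. destruct (inv_qpoch_bound q Hq) as [M [HM B]].
  destruct (iqinf_near_1 q Hq) as [M' [HM' B']].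
  pose proof (Cmod_ge_0 q). pose proof (Cmod_ge_0 a).
  apply Clim_geom with (K := (M * M')%R) (r := Cmod q); [lra|].
  intros n.
  assert (HP : qpoch (- a) q n <> 0) by (apply qpoch_neq_0; rewrite ?Cmod_opp; lra).
  replace (/ qpoch (- a) q n - iqinf a q)
    with (- (/ qpoch (- a) q n * (iqinf (a * q ^ n) q - 1))).
  2:{ rewrite iqinf_shift_n by lra. field. exact HP. }
  rewrite Cmod_opp, Cmod_mult, Rmult_assoc.
  pose proof (pow_le_1 (Cmod q) n ltac:(lra)).
  apply Rmult_le_compat; try apply Cmod_ge_0.
  - apply B. now rewrite Cmod_opp.
  - eapply Rle_trans; [apply B'|]; rewrite Cmod_mult, Cmod_pow; [nra|].
    apply Rmult_le_compat_l; nra.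
Qed.

(** The n-th term is 1 / (-a; q)_n - 1 / (-a; q)_(n+1), so the series telescopes. *)
Lemma iqinf_series (a q : C) : (Cmod q < 1)%R -> (Cmod a <= Cmod q)%R ->
  is_series (fun n => a * q ^ n / qpoch (- a) q (S n)) (1 - iqinf a q).
Proof.
  intros Hq Ha. pose proof (is_series_telescope _ _ (iqinf_lim a q Hq Ha)) as T.
  simpl in T. replace (/ 1 - iqinf a q) with (1 - iqinf a q) in T by field.
  eapply is_series_ext_C; [|exact T]. intros n. simpl.
  assert (qpoch (- a) q n <> 0) by (apply qpoch_neq_0; rewrite ?Cmod_opp; lra).
  assert (1 - - a * q ^ n <> 0)
    by (apply one_minus_neq_0, qpoch_factor_lt_1; rewrite ?Cmod_opp; lra).
  field. now split.
Qed.

(** * The Lambert-type series V and L *)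

Lemma lambert_weight_bound (q : C) (n : nat) : (Cmod q < 1)%R ->
  (Cmod (q ^ S n / (1 - q ^ S n)) <= / (1 - Cmod q) * Cmod q ^ n)%R.
Proof.
  intros Hq. pose proof (Cmod_ge_0 q).
  pose proof (Cmod_pow_S_le q n Hq). pose proof (Cmod_1_minus_ge (q ^ S n)).
  rewrite Cmod_div by (apply one_minus_neq_0; lra).
  unfold Rdiv. rewrite (Rmult_comm (/ (1 - Cmod q))).
  apply Rmult_le_compat.
  - apply Cmod_ge_0.
  - left. apply Rinv_0_lt_compat. lra.
  - rewrite Cmod_pow. simpl. pose proof (pow_le_1 (Cmod q) n). nra.
  - apply Rinv_le_contravar; lra.
Qed.

Lemma is_Cseries_lambert (q : C) (f : nat -> C) (K : R) : (Cmod q < 1)%R ->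
  (forall n, (Cmod (f n) <= K)%R) ->
  is_series (fun n => q ^ S n / (1 - q ^ S n) * f n)
    (Cseries (fun n => q ^ S n / (1 - q ^ S n) * f n)).
Proof.
  intros Hq Hf. pose proof (Cmod_ge_0 q).
  apply is_Cseries_geom with (K := (/ (1 - Cmod q) * K)%R) (r := Cmod q); [lra|].
  intros n. rewrite Cmod_mult.
  replace (/ (1 - Cmod q) * K * Cmod q ^ n)%R
    with (/ (1 - Cmod q) * Cmod q ^ n * K)%R by ring.
  apply Rmult_le_compat; try apply Cmod_ge_0; [now apply lambert_weight_bound | apply Hf].
Qed.

Lemma lambert_series_bound (q : C) (f : nat -> C) (l : C) (K : R) : (Cmod q < 1)%R ->
  (forall n, (Cmod (f n) <= K)%R) ->
  is_series (fun n => q ^ S n / (1 - q ^ S n) * f n) l ->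
  (Cmod l <= / (1 - Cmod q) * K / (1 - Cmod q))%R.
Proof.
  intros Hq Hf Hl. pose proof (Cmod_ge_0 q).
  eapply series_geom_bound; [| |exact Hl]; [lra|].
  intros n. cbv beta. rewrite Cmod_mult.
  replace (/ (1 - Cmod q) * K * Cmod q ^ n)%R
    with (/ (1 - Cmod q) * Cmod q ^ n * K)%R by ring.
  apply Rmult_le_compat; try apply Cmod_ge_0; [now apply lambert_weight_bound | apply Hf].
Qed.

(** [lamV] and [lamL] are V(a) and L(a) of the header, with the summation index lowered by one. *)
Definition lamV (a q : C) : C :=
  Cseries (fun n => q ^ S n / (1 - q ^ S n) * / qpoch (- a) q (S n)).

Definition lamL (a q : C) : C :=
  Cseries (fun n => q ^ S n / (1 - q ^ S n) * qpoch a q (S n)).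

Lemma lamV_series (a q : C) : (Cmod q < 1)%R -> (Cmod a <= Cmod q)%R ->
  is_series (fun n => q ^ S n / (1 - q ^ S n) * / qpoch (- a) q (S n)) (lamV a q).
Proof.
  intros Hq Ha. destruct (inv_qpoch_bound q Hq) as [M [_ B]].
  apply is_Cseries_lambert with (K := M); [exact Hq|].
  intros n. apply B. now rewrite Cmod_opp.
Qed.

Lemma lamL_series (a q : C) : (Cmod q < 1)%R -> (Cmod a <= 1)%R ->
  is_series (fun n => q ^ S n / (1 - q ^ S n) * qpoch a q (S n)) (lamL a q).
Proof.
  intros Hq Ha. destruct (qpoch_near_1 q Hq) as [M [_ B]].
  apply is_Cseries_lambert with (K := (1 + M * Cmod a)%R); [exact Hq|].
  intros n. now apply Cmod_le_near_1, B.
Qed.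

(** Since (-aq; q)_n = (-a; q)_(n+1) / (1 + a), the difference 1 / (-a; q)_n - 1 / (-aq; q)_n equals
    -a (1 - q^n) / (-a; q)_(n+1). Its factor 1 - q^n cancels the denominator of w_n and leaves a
    telescoping series. *)
Lemma lamV_shift (a q : C) : (Cmod q < 1)%R -> (Cmod a <= Cmod q)%R ->
  lamV a q - lamV (a * q) q = iqinf a q - / (1 + a).
Proof.
  intros Hq Ha.
  assert (Haq : (Cmod (a * q) <= Cmod q)%R) by (pose proof (Cmod_mult_le a q); lra).
  assert (Ha1 : 1 + a <> 0) by (apply one_plus_neq_0; lra).
  pose proof (is_series_minus_C _ _ _ _ (lamV_series a q Hq Ha) (lamV_series (a * q) q Hq Haq)) as D.
  (* The sum defining V starts at n = 1, so the term a / (1 + a) of index 0 is removed from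
     [iqinf_series]. *)
  pose proof (proj1 (is_series_shift_C _ _) (iqinf_series a q Hq Ha)) as T.
  apply (is_series_scal_C (- (1))) in T.
  replace (iqinf a q - / (1 + a))
    with (- (1) * (1 - iqinf a q - a * q ^ 0 / qpoch (- a) q 1)).
  2:{ simpl. field. exact Ha1. }
  eapply is_series_unique_C; [exact D|]. eapply is_series_ext_C; [|exact T].
  intros n.
  assert (E1 : qpoch (- a) q (S (S n)) = (1 + a) * qpoch (- (a * q)) q (S n)).
  { rewrite qpoch_shift. replace (- a * q) with (- (a * q)) by ring. ring. }
  assert (E2 : qpoch (- a) q (S (S n)) = qpoch (- a) q (S n) * (1 + a * q ^ S n)).
  { change (qpoch (- a) q (S (S n))) with (qpoch (- a) q (S n) * (1 - - a * q ^ S n)). ring. }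
  assert (H1 : qpoch (- (a * q)) q (S n) <> 0) by (apply qpoch_neq_0; rewrite ?Cmod_opp; lra).
  assert (H2 : qpoch (- a) q (S n) <> 0) by (apply qpoch_neq_0; rewrite ?Cmod_opp; lra).
  assert (H3 : 1 + a * q ^ S n <> 0).
  { apply one_plus_neq_0, qpoch_factor_lt_1; lra. }
  assert (H4 : 1 - q ^ S n <> 0) by now apply one_minus_neq_0, Cmod_pow_S_lt_1.
  replace (/ qpoch (- (a * q)) q (S n)) with ((1 + a) / qpoch (- a) q (S (S n))).
  2:{ rewrite E1. field. now split. }
  rewrite E2. field. auto.
Qed.

(** Here (aq; q)_n - (a; q)_n = a (1 - q^n) (aq; q)_(n-1); the weight w_n again loses its
    denominator, and the series of [qinf_series] at aq remains. *)
Lemma lamL_shift (a q : C) : (Cmod q < 1)%R -> (Cmod a <= 1)%R ->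
  lamL (a * q) q - lamL a q = 1 - qinf (a * q) q.
Proof.
  intros Hq Ha.
  assert (Haq : (Cmod (a * q) <= 1)%R) by (pose proof (Cmod_mult_le a q); lra).
  pose proof (is_series_minus_C _ _ _ _ (lamL_series (a * q) q Hq Haq) (lamL_series a q Hq Ha)) as D.
  eapply is_series_unique_C; [exact D|].
  eapply is_series_ext_C; [|apply (qinf_series (a * q) q Hq Haq)].
  intros n.
  assert (H4 : 1 - q ^ S n <> 0) by now apply one_minus_neq_0, Cmod_pow_S_lt_1.
  rewrite (qpoch_shift a). simpl qpoch.
  replace (a * q * q ^ n) with (a * q ^ S n) by (simpl; ring). field. exact H4.
Qed.

Lemma lamL_1 (q : C) : (Cmod q < 1)%R -> lamL 1 q = 0.
Proof.
  intros Hq. eapply is_series_unique_C.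
  - apply lamL_series; [exact Hq|]. rewrite Cmod_1. lra.
  (* Each (1; q)_n with n >= 1 contains the factor 1 - 1; the zero series is obtained as 0 times a
     convergent one. *)
  - replace (0 : C) with (0 * lamL 1 q) by ring.
    eapply is_series_ext_C; [|apply is_series_scal_C, (lamL_series 1 q Hq); rewrite Cmod_1; lra].
    intros n. simpl. rewrite (qpoch_shift 1 q n : qpoch 1 q n * (1 - 1 * q ^ n) = _). ring.
Qed.

(** Both 1 / (-aq; q)_n and (a; q)_n are 1 + O(a) uniformly in n, so the two Lambert series differ
    by O(a). This makes the telescoping in [lamV_decomposition] end at 0. *)
Lemma lamV_minus_lamL (q : C) : (Cmod q < 1)%R ->
  exists K : R, forall a, (Cmod a <= 1)%R ->
    (Cmod (lamV (a * q) q - lamL a q) <= K * Cmod a)%R.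
Proof.
  intros Hq. destruct (qpoch_near_1 q Hq) as [M [HM B]].
  destruct (inv_qpoch_near_1 q Hq) as [M' [HM' B']]. pose proof (Cmod_ge_0 q).
  exists (/ (1 - Cmod q) * (M' + M) / (1 - Cmod q))%R. intros a Ha.
  pose proof (Cmod_ge_0 a).
  replace (/ (1 - Cmod q) * (M' + M) / (1 - Cmod q) * Cmod a)%R
    with (/ (1 - Cmod q) * ((M' + M) * Cmod a) / (1 - Cmod q))%R by (field; lra).
  assert (Haq : (Cmod (a * q) <= Cmod q)%R) by (rewrite Cmod_mult; nra).
  apply (lambert_series_bound q (fun n => / qpoch (- (a * q)) q (S n) - qpoch a q (S n)));
    [exact Hq | |].
  - intros n. eapply Rle_trans; [apply (Cmod_minus_triangle _ 1)|].
    rewrite Rmult_plus_distr_r. apply Rplus_le_compat.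
    + eapply Rle_trans; [apply B'; now rewrite Cmod_opp|].
      apply Rmult_le_compat_l; [exact HM'|]. rewrite Cmod_opp. apply Cmod_mult_le. lra.
    + rewrite Cmod_sym. now apply B.
  - eapply is_series_ext_C;
      [|apply is_series_minus_C; [apply lamV_series; assumption|apply lamL_series; assumption]].
    intros n. simpl. ring.
Qed.

(** The quantity V(q^(k+1)) - L(q^k) starts at V(q) - L(1) = V(q) and tends to 0. Its decrements
    come from the two shift lemmas, with 1 - 1 / (1 + y) = y / (1 + y) for y = q^(k+1). *)
Lemma lamV_decomposition (q : C) : (Cmod q < 1)%R ->
  is_series (fun k => q ^ S k / (1 + q ^ S k) + (iqinf (q ^ S k) q - qinf (q ^ S k) q))
    (lamV q q).
Proof.
  intros Hq. destruct (lamV_minus_lamL q Hq) as [K B]. pose proof (Cmod_ge_0 q).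
  assert (Hpow : forall k, (Cmod (q ^ k) <= 1)%R).
  { intros k. rewrite Cmod_pow. apply pow_le_1. lra. }
  assert (T : Clim (fun k => lamV (q ^ k * q) q - lamL (q ^ k) q) 0).
  { apply Clim_geom with (K := K) (r := Cmod q); [lra|]. intros k.
    replace (lamV (q ^ k * q) q - lamL (q ^ k) q - 0)
      with (lamV (q ^ k * q) q - lamL (q ^ k) q) by ring.
    rewrite <- Cmod_pow. now apply B. }
  apply is_series_telescope in T. simpl in T.
  replace (1 * q) with q in T by ring. rewrite lamL_1 in T by exact Hq.
  replace (lamV q q - 0 - 0) with (lamV q q) in T by ring.
  eapply is_series_ext_C; [|exact T]. intros k. simpl.
  assert (E : q * q ^ k = q ^ k * q) by ring. rewrite !E.
  assert (Hk : (Cmod (q ^ k * q) <= Cmod q)%R).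
  { rewrite <- E. now apply (Cmod_pow_S_le q k). }
  assert (Hk1 : 1 + q ^ k * q <> 0) by (apply one_plus_neq_0; lra).
  pose proof (lamV_shift (q ^ k * q) q Hq Hk) as EV.
  pose proof (lamL_shift (q ^ k) q Hq (Hpow k)) as EL.
  replace (lamV (q ^ k * q) q - lamL (q ^ k) q
           - (lamV (q ^ k * q * q) q - lamL (q ^ k * q) q))
    with ((lamV (q ^ k * q) q - lamV (q ^ k * q * q) q)
          + (lamL (q ^ k * q) q - lamL (q ^ k) q)) by ring.
  rewrite EV, EL. field. exact Hk1.
Qed.

(** * The series over (q; q^2)_k *)

Lemma qinf_pow_lim (q : C) : (Cmod q < 1)%R -> Clim (fun j => qinf (q ^ j) q) 1.
Proof.
  intros Hq. destruct (qinf_near_1 q Hq) as [M [_ B]]. pose proof (Cmod_ge_0 q).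
  apply Clim_geom with (K := M) (r := Cmod q); [lra|]. intros j.
  rewrite <- Cmod_pow. apply B. rewrite Cmod_pow. apply pow_le_1. lra.
Qed.

Lemma qinf_pow_shift (q : C) (j : nat) : (Cmod q < 1)%R ->
  qinf (q ^ j) q = (1 - q ^ j) * qinf (q ^ S j) q.
Proof.
  intros Hq. pose proof (Cmod_ge_0 q). rewrite qinf_shift.
  - simpl. now replace (q ^ j * q) with (q * q ^ j) by ring.
  - exact Hq.
  - rewrite Cmod_pow. apply pow_le_1. lra.
Qed.

(** Induction on n from the recurrence p_(j-1) = (1 - q^j) p_j, where p_j is [qinf (q ^ S j) q]. *)
Lemma qpoch_expansion (q : C) (n : nat) : (Cmod q < 1)%R ->
  is_series (fun j => qinf (q ^ S j) q * (q ^ S n) ^ j) (qpoch q q n).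
Proof.
  intros Hq. induction n as [|n IH].
  - pose proof (is_series_telescope _ _ (qinf_pow_lim q Hq)) as T.
    apply (is_series_scal_C (- (1))) in T.
    (* The telescoping sum is 1 - (1; q)_oo, and (1; q)_oo = 0. *)
    replace (qpoch q q 0) with (- (1) * (qinf (q ^ 0) q - 1)).
    2:{ rewrite qinf_pow_shift by exact Hq. simpl. ring. }
    eapply is_series_ext_C; [|exact T]. intros j. simpl.
    rewrite (qinf_pow_shift q j Hq). simpl. replace (q * 1) with q by ring. ring.
  - set (a := q ^ S n) in *.
    (* By the recurrence, the weight 1 - q^j turns p_j into p_(j-1): this series is the induction
       hypothesis moved by one index, hence the factor a. Subtracting it replaces a^j by (q a)^j. *)
    assert (T : is_series (fun j => (1 - q ^ j) * (qinf (q ^ S j) q * a ^ j)) (a * qpoch q q n)).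
    { apply is_series_shift_C. simpl (q ^ 0).
      replace (a * qpoch q q n - (1 - 1) * (qinf (q ^ 1) q * a ^ 0))
        with (a * qpoch q q n) by ring.
      eapply is_series_ext_C; [|apply (is_series_scal_C a _ _ IH)].
      intros j. cbv beta. rewrite (qinf_pow_shift q (S j) Hq), (Cpow_S a). ring. }
    change (qpoch q q (S n)) with (qpoch q q n * (1 - a)).
    replace (qpoch q q n * (1 - a)) with (qpoch q q n - a * qpoch q q n) by ring.
    eapply is_series_ext_C; [|apply (is_series_minus_C _ _ _ _ IH T)].
    intros j. cbv beta. change (q ^ S (S n)) with (q * a). rewrite Cpow_mult_l. ring.
Qed.

Lemma qpoch_double (q : C) (k : nat) :
  qpoch q q (2 * k) = qpoch q (q ^ 2) k * qpoch (q ^ 2) (q ^ 2) k.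
Proof.
  induction k as [|k IH]; [simpl; ring|].
  replace (2 * S k)%nat with (S (S (2 * k))) by lia.
  change (qpoch q q (S (S (2 * k))))
    with (qpoch q q (2 * k) * (1 - q * q ^ (2 * k)) * (1 - q * (q * q ^ (2 * k)))).
  rewrite IH, Cpow_mult_r. simpl. ring.
Qed.

(** The order |q|^(2j) is split into two factors: one pays for the division by q^j, the other
    ensures summability. *)
Lemma qinf_diff_bound (q : C) : (Cmod q < 1)%R ->
  exists M : R, forall j,
    (Cmod (iqinf (q ^ S j) q - qinf (q ^ S j) q) <= M * (Cmod q ^ j * Cmod q ^ j))%R.
Proof.
  intros Hq. destruct (iqinf_minus_qinf q Hq) as [M [HM B]]. pose proof (Cmod_ge_0 q).
  exists M. intros j. eapply Rle_trans; [apply B; now apply Cmod_pow_S_le|].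
  apply Rmult_le_compat_l; [exact HM|]. rewrite Cmod_pow.
  pose proof (pow_le_1 (Cmod q) j ltac:(lra)).
  simpl. rewrite Rmult_1_r. apply Rmult_le_compat; nra.
Qed.

Lemma is_Cseries_qinf_diff (q : C) : (Cmod q < 1)%R ->
  is_series (fun j => iqinf (q ^ S j) q - qinf (q ^ S j) q)
    (Cseries (fun j => iqinf (q ^ S j) q - qinf (q ^ S j) q)).
Proof.
  intros Hq. destruct (qinf_diff_bound q Hq) as [M B]. pose proof (Cmod_ge_0 q).
  apply is_Cseries_geom with (K := M) (r := Cmod q); [lra|].
  intros j. eapply Rle_trans; [apply B|].
  assert (0 <= M)%R.
  { pose proof (Cmod_ge_0 (iqinf (q ^ 1) q - qinf (q ^ 1) q)). specialize (B O). simpl in *. lra. }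
  apply Rmult_le_compat_l; [assumption|]. pose proof (pow_le_1 (Cmod q) j). nra.
Qed.

Lemma qinf_diff_weighted_bound (q : C) : (0 < Cmod q < 1)%R ->
  exists M : R, forall j,
    (Cmod ((iqinf (q ^ S j) q - qinf (q ^ S j) q) / q ^ j) <= M * Cmod q ^ j)%R.
Proof.
  intros Hq. destruct (qinf_diff_bound q (proj2 Hq)) as [M B].
  assert (Hq0 : q <> 0) by (apply Cmod_gt_0; lra).
  exists M. intros j. rewrite Cmod_div, Cmod_pow by now apply Cpow_nz.
  assert (0 < Cmod q ^ j)%R by (apply pow_lt; lra).
  apply Rmult_le_reg_r with (Cmod q ^ j)%R; [assumption|].
  unfold Rdiv. rewrite !Rmult_assoc, Rinv_l, Rmult_1_r by lra. apply B.
Qed.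

Lemma qinf_diff_weighted_eq (q : C) (j : nat) : 
  (iqinf (q ^ S j) q - qinf (q ^ S j) q) / q ^ j
  = qinf (q ^ S j) q / q ^ j * (euler ((q ^ 2) ^ S j) (q ^ 2) - 1).
Proof.
  unfold iqinf. rewrite <- (Cpow_mult_r q (S j) 2), <- (Cpow_mult_r q 2 (S j)), Nat.mul_comm.
  unfold Cdiv. ring.
Qed.

(** With finitely many k, exchanging the sums over k and j is only addition of convergent series.
    The infinite exchange then reduces to estimating an Euler tail. *)
Lemma odd_qpoch_lambert_partial_sum (q : C) (M : nat) : (0 < Cmod q < 1)%R ->
  is_series
    (fun j => qinf (q ^ S j) q / q ^ j *
       csum (fun k => ((q ^ 2) ^ S j) ^ S k / qpoch (q ^ 2) (q ^ 2) (S k)) M)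
    (csum (fun k => qpoch q (q ^ 2) k * (q ^ (2 * S k) / (1 - q ^ (2 * S k)))) M).
Proof.
  intros Hq. assert (Hq0 : q <> 0) by (apply Cmod_gt_0; lra).
  assert (HQ : (Cmod (q ^ 2) < 1)%R) by (apply Cmod_sqr_lt_1; lra).
  induction M as [|M IH].
  - simpl csum. replace (0 : C) with (0 * qpoch q q 0) by ring.
    eapply is_series_ext_C; [|apply is_series_scal_C, (qpoch_expansion q 0 (proj2 Hq))].
    intros j. simpl. ring.
  - set (c := (q ^ 2) ^ S M / qpoch (q ^ 2) (q ^ 2) (S M)).
    (* Here (q; q^2)_M = (q; q)_(2M) / (q^2; q^2)_M, and the Lambert denominator completes (q^2;
       q^2)_(M+1). *)
    assert (E : qpoch q (q ^ 2) M * (q ^ (2 * S M) / (1 - q ^ (2 * S M)))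
                = c * qpoch q q (2 * M)).
    { unfold c. rewrite qpoch_double, (Cpow_mult_r q 2 (S M)).
      change (qpoch (q ^ 2) (q ^ 2) (S M))
        with (qpoch (q ^ 2) (q ^ 2) M * (1 - (q ^ 2) ^ S M)).
      assert (qpoch (q ^ 2) (q ^ 2) M <> 0) by now apply qpoch_neq_0.
      assert (1 - (q ^ 2) ^ S M <> 0) by now apply one_minus_neq_0, Cmod_pow_S_lt_1.
      generalize dependent ((q ^ 2) ^ S M). intros y _ Hy. field. now split. }
    rewrite csum_S, E.
    eapply is_series_ext_C;
      [|apply is_series_plus_C;
          [exact IH | apply is_series_scal_C, (qpoch_expansion q (2 * M) (proj2 Hq))]].
    intros j. cbv beta. rewrite csum_S, Cmult_plus_distr_l. f_equal.
    unfold c. set (P := qpoch (q ^ 2) (q ^ 2) (S M)).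
    assert (HP : P <> 0) by now apply qpoch_neq_0.
    assert (Hj : q ^ j <> 0) by now apply Cpow_nz.
    (* The exponent identity 2(j+1)(M+1) = 2(M+1) + (2M+1)j + j is the origin of the weight 1 /
       q^j. *)
    assert (X : ((q ^ 2) ^ S j) ^ S M = (q ^ 2) ^ S M * (q ^ S (2 * M)) ^ j * q ^ j).
    { rewrite <- !Cpow_mult_r, <- !Cpow_add_r. f_equal. nia. }
    rewrite X. field. now split.
Qed.

(** [S1] is defined by the series over j. Its distance to the n-th partial sum over k is a series
    over j of Euler tails, of size O(|q|^n). *)
Lemma odd_qpoch_lambert_series (q : C) : (0 < Cmod q < 1)%R ->
  exists S1 : C,
    is_series (fun k => qpoch q (q ^ 2) k * (q ^ (2 * S k) / (1 - q ^ (2 * S k)))) S1 /\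
    is_series (fun j => (iqinf (q ^ S j) q - qinf (q ^ S j) q) / q ^ j) S1.
Proof.
  intros Hq. assert (Hq0 : q <> 0) by (apply Cmod_gt_0; lra).
  assert (HQ : (Cmod (q ^ 2) < 1)%R) by (apply Cmod_sqr_lt_1; lra).
  destruct (qinf_diff_weighted_bound q Hq) as [M0 B0].
  pose proof (is_Cseries_geom _ M0 (Cmod q) ltac:(lra) B0) as HS.
  eexists. split; [|exact HS].
  destruct (euler_tail (q ^ 2) HQ) as [M [HM B]].
  destruct (qinf_near_1 q (proj2 Hq)) as [M' [HM' B']].
  apply is_series_csum.
  apply Clim_geom with (K := ((1 + M') * M / (1 - Cmod q))%R) (r := Cmod q); [lra|].
  intros n. rewrite Cmod_sym.
  pose proof (is_series_minus_C _ _ _ _ HS (odd_qpoch_lambert_partial_sum q n Hq)) as D.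
  replace ((1 + M') * M / (1 - Cmod q) * Cmod q ^ n)%R
    with ((1 + M') * M * Cmod q ^ n / (1 - Cmod q))%R by (field; lra).
  eapply series_geom_bound; [| |exact D]; [lra|].
  intros j. cbv beta. rewrite qinf_diff_weighted_eq.
  set (x := (q ^ 2) ^ S j).
  assert (Hx : (Cmod x <= Cmod (q ^ 2))%R) by now apply Cmod_pow_S_le.
  (* The sum over k starts at Euler index 1, so n of its terms and the constant term 1 make n + 1
     Euler terms. *)
  specialize (B x (S n) Hx). rewrite csum_S_l in B.
  replace (qinf (q ^ S j) q / q ^ j * (euler x (q ^ 2) - 1)
     - qinf (q ^ S j) q / q ^ j * csum (fun k => x ^ S k / qpoch (q ^ 2) (q ^ 2) (S k)) n)
    with (qinf (q ^ S j) q / q ^ j * (euler x (q ^ 2) -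
       (x ^ 0 / qpoch (q ^ 2) (q ^ 2) 0 + csum (fun k => x ^ S k / qpoch (q ^ 2) (q ^ 2) (S k)) n))).
  2:{ change (x ^ 0 / qpoch (q ^ 2) (q ^ 2) 0) with ((1 : C) / 1). field. now apply Cpow_nz. }
  assert (Hp : (Cmod (qinf (q ^ S j) q) <= 1 + M')%R).
  { pose proof (Cmod_pow_S_lt_1 q j (proj2 Hq)).
    pose proof (Cmod_le_near_1 _ _ (B' (q ^ S j) ltac:(lra))).
    pose proof (Cmod_ge_0 (q ^ S j)). nra. }
  assert (Hr : (0 < Cmod q ^ j)%R) by (apply pow_lt; lra).
  rewrite Cmod_mult, Cmod_div, Cmod_pow by now apply Cpow_nz.
  (* Of the exponent 2(j+1)(n+1) only 2j + n is kept: one j compensates 1 / q^j, the other sums over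
     j, and n gives the convergence. *)
  assert (Hxn : (Cmod x ^ S n <= Cmod q ^ j * (Cmod q ^ n * Cmod q ^ j))%R).
  { unfold x. rewrite !Cmod_pow, <- !pow_mult, <- !pow_add.
    replace (2 * (S j * S n))%nat with (j + (n + j) + (2 + n + 2 * (j * n)))%nat by nia.
    rewrite (pow_add _ (j + (n + j))).
    pose proof (pow_le_1 (Cmod q) (j + (n + j))).
    pose proof (pow_le_1 (Cmod q) (2 + n + 2 * (j * n))). nra. }
  apply Rle_trans with ((1 + M') / Cmod q ^ j * (M * (Cmod q ^ j * (Cmod q ^ n * Cmod q ^ j))))%R.
  - apply Rmult_le_compat; try apply Cmod_ge_0.
    + apply Rmult_le_pos; [apply Cmod_ge_0 | left; now apply Rinv_0_lt_compat].
    + apply Rmult_le_compat_r; [left; now apply Rinv_0_lt_compat | exact Hp].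
    + eapply Rle_trans; [exact B|]. now apply Rmult_le_compat_l.
  - right. field. lra.
Qed.

(* Uses [q^(j+1) (e_j - p_(j+1)) = d_(j+1) - d_j], in the notation of the header. *)
Lemma qinf_diff_abel_sum (q S1 D : C) : (0 < Cmod q < 1)%R ->
  is_series (fun j => (iqinf (q ^ S j) q - qinf (q ^ S j) q) / q ^ j) S1 ->
  is_series (fun j => iqinf (q ^ S j) q - qinf (q ^ S j) q) D ->
  (1 - 1 / q) * S1 = D + iqinf q q - 1.
Proof.
  intros Hq H1 HD. assert (Hq0 : q <> 0) by (apply Cmod_gt_0; lra).
  destruct (qinf_diff_weighted_bound q Hq) as [M0 B0].
  assert (T : Clim (fun j => (iqinf (q ^ S j) q - qinf (q ^ S j) q) / q ^ j) 0).
  { apply Clim_geom with (K := M0) (r := Cmod q); [lra|]. intros j.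
    unfold Cminus at 1. rewrite Copp_0, Cplus_0_r. apply B0. }
  apply is_series_telescope in T.
  pose proof (proj2 (Clim_incr_1 _ _) (qinf_pow_lim q (proj2 Hq))) as P.
  apply is_series_telescope in P.
  (* The terms d_j / q^j - d_(j+1) / q^(j+1), d_j and p_j - p_(j+1) add up to (1 - 1/q) d_j / q^j;
     the first and third telescope. *)
  pose proof (is_series_plus_C _ _ _ _ (is_series_plus_C _ _ _ _ T HD) P) as A.
  replace (D + iqinf q q - 1)
    with ((iqinf (q ^ 1) q - qinf (q ^ 1) q) / q ^ 0 - 0 + D + (qinf (q ^ 1) q - 1)).
  2:{ rewrite Cpow_1_r. simpl. field. }
  eapply is_series_unique_C; [apply is_series_scal_C, H1|].
  eapply is_series_ext_C; [|exact A]. intros j. cbv beta.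
  (* The recurrences express everything through e_j and p_(j+1), after which the identity is purely
     rational. *)
  rewrite (qinf_pow_shift q (S j)) by lra.
  replace (iqinf (q ^ S (S j)) q) with ((1 + q ^ S j) * iqinf (q ^ S j) q).
  2:{ rewrite <- iqinf_shift by (try apply Cmod_pow_S_lt_1; lra). f_equal. simpl. ring. }
  assert (Hj : q ^ j <> 0) by now apply Cpow_nz.
  generalize (iqinf (q ^ S j) q) (qinf (q ^ S (S j)) q). intros e p.
  rewrite (Cpow_S q j). field. now split.
Qed.

(** * The series over 1 / (-q; q)_n and the conclusion *)

(** With y = q^(n+1), y^2 / (1 - y^2) = (y / (1 - y) - y) / (1 + y), and 1 + y is the last factor of
    (-q; q)_(n+1). The two parts are the terms of V(q) and of [iqinf_series] at a = q. *)
Lemma inv_qpoch_lambert_series (q : C) : (Cmod q < 1)%R ->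
  is_series (fun n => 1 / qpoch (- q) q n * (q ^ (2 * S n) / (1 - q ^ (2 * S n))))
    (lamV q q - (1 - iqinf q q)).
Proof.
  intros Hq.
  eapply is_series_ext_C;
    [|apply is_series_minus_C; [apply lamV_series; lra | apply (iqinf_series q q Hq); lra]].
  intros n. cbv beta.
  assert (H1 : 1 - q ^ S n <> 0) by now apply one_minus_neq_0, Cmod_pow_S_lt_1.
  assert (H2 : 1 + q ^ S n <> 0) by now apply one_plus_neq_0, Cmod_pow_S_lt_1.
  assert (H3 : qpoch (- q) q n <> 0) by (apply qpoch_neq_0; rewrite ?Cmod_opp; lra).
  change (qpoch (- q) q (S n)) with (qpoch (- q) q n * (1 - - q * q ^ n)).
  replace (1 - - q * q ^ n) with (1 + q ^ S n) by (simpl; ring).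
  change (q * q ^ n) with (q ^ S n).
  rewrite Nat.mul_comm, Cpow_mult_r.
  generalize dependent (q ^ S n). intros y H1 H2.
  assert (H4 : 1 - y ^ 2 <> 0).
  { replace (1 - y ^ 2) with ((1 - y) * (1 + y)) by ring. now apply Cmult_neq_0. }
  field. auto.
Qed.

Theorem theorem1p2 (q : C) (hq : (0 < Cmod q < 1)%R) :
  exists S1 S2 S3 : C,
    is_series_from1
      (fun m : nat =>
         (qpoch q (q ^ 2) (m - 1) * (q ^ (2 * m) / (1 - q ^ (2 * m))))%C) S1 /\
    is_series_from1
      (fun n : nat =>
         (1 / qpoch (- q) q (n - 1) * (q ^ (2 * n) / (1 - q ^ (2 * n))))%C) S2 /\
    is_series_from1
      (fun n : nat => (q ^ n / (1 + q ^ n))%C) S3 /\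
    ((1 - 1 / q) * S1 = S2 - S3)%C.
Proof.
  destruct (odd_qpoch_lambert_series q hq) as [S1 [H1 H1']].
  pose proof (is_Cseries_qinf_diff q (proj2 hq)) as HD.
  set (D := Cseries _) in HD.
  (* V(q) cancels in S2 - S3, leaving D + e_0 - 1, the value given by [qinf_diff_abel_sum]. *)
  exists S1, (lamV q q - (1 - iqinf q q)), (lamV q q - D). repeat split.
  - eapply is_series_ext_C; [|exact H1]. intros k. cbv beta.
    now replace (S k - 1)%nat with k by lia.
  - eapply is_series_ext_C; [|apply (inv_qpoch_lambert_series q (proj2 hq))]. intros k. cbv beta.
    now replace (S k - 1)%nat with k by lia.
  - eapply is_series_ext_C;
      [|apply (is_series_minus_C _ _ _ _ (lamV_decomposition q (proj2 hq)) HD)].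
    intros k. cbv beta. ring.
  - rewrite (qinf_diff_abel_sum q S1 D hq H1' HD). ring.
Qed.
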